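(* Let $s\in\mathbb{C}$ with $\Re(s)>1$ and let $z$ be a primitive $q$-th root of unity with $q\ge 1$. Let $k>2$ be an integer of the form $k=bq+1$ for some positive integer $b$. Then $$\sum_{d\mid k}\frac{\mu(d)}{d^s}\mathrm{Li}_{z^d}(s)=\sum_{\substack{1\le h\le k/2\\ (h,k)=1}}z^hh^{-s}+\sum_{m\ge 0}\frac{P_m(s)\,\mathrm{Li}_z(s+m)}{k^{s+m}}\sum_{\substack{1\le h\le k/2\\ (h,k)=1}}\left(z^h(-1)^m+z^{-h}\right)h^m .$$
   Context: For a root of unity $w$ and $\Re(s)>1$, $\mathrm{Li}_w(s):=\sum_{n\ge1}\frac{w^n}{n^s}$. For $m\ge 0$, $P_0(s)=1$ and $P_m(s)=\frac{s(s+1)\cdots(s+m-1)}{m!}$ for $m\ge1$. $\mu$ is the Möbius function and $(h,k)$ denotes the greatest common divisor of $h$ and $k$. *)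

(* Defs.v *)
(* Analysis over Coquelicot's complex numbers [C]; elementary number theory and
   finite sums from MathComp's boot library. *)
From HB Require Import structures.
From Stdlib Require Import Reals.
From mathcomp Require Import all_boot.
From Coquelicot Require Import Coquelicot.

Set Implicit Arguments.
Unset Strict Implicit.
Unset Printing Implicit Defensive.

Local Open Scope C_scope.

HB.instance Definition _ :=
  Monoid.isComLaw.Build C (RtoC 0) Cplus
    Cplus_assoc Cplus_comm Cplus_0_l.
HB.instance Definition _ :=
  Monoid.isComLaw.Build C (RtoC 1) Cmult
    Cmult_assoc Cmult_comm Cmult_1_l.

Definition natC (n : nat) : C := RtoC (INR n).

Definition Cexp (z : C) : C :=
  RtoC (exp (Re z)) * (cos (Im z), sin (Im z)).

(* [n ^ s = exp (s log n)] with the real logarithm; only meaningful for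
   [0 < n], since Stdlib's [ln] vanishes on nonpositive reals. *)
Definition cpowN (n : nat) (s : C) : C := Cexp (s * RtoC (ln (INR n))).

(* Coquelicot's total operator [Series] is real-valued; like [Series], this is
   the sum only when the series converges. *)
Definition CSeries (a : nat -> C) : C :=
  (Series (fun n => Re (a n)), Series (fun n => Im (a n))).

Lemma is_series_CSeries (a : nat -> C) (l : C) :
  @is_series C_AbsRing C_NormedModule a l -> CSeries a = l.
Proof.
move=> al.
have re_sum n : sum_n (fun n => Re (a n)) n = Re (sum_n a n).
  by elim: n => [|n IHn]; rewrite ?sum_O // !sum_Sn IHn.
have im_sum n : sum_n (fun n => Im (a n)) n = Im (sum_n a n).
  by elim: n => [|n IHn]; rewrite ?sum_O // !sum_Sn IHn.
rewrite /CSeries [RHS]surjective_pairing; congr pair; apply: is_series_unique.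
- apply: (filterlim_ext (fun n => Re (sum_n a n))) => [n|]; first by rewrite re_sum.
  by apply: (filterlim_comp _ _ _ _ _ _ _ _ al) => P [e Pe]; exists e => y [? _]; apply: Pe.
- apply: (filterlim_ext (fun n => Im (sum_n a n))) => [n|]; first by rewrite im_sum.
  by apply: (filterlim_comp _ _ _ _ _ _ _ _ al) => P [e Pe]; exists e => y [_ ?]; apply: Pe.
Qed.

(* The summation index is shifted by one, so that it starts at [n = 1]. *)
Definition Li (w s : C) : C :=
  CSeries (fun n => w ^ n.+1 / cpowN n.+1 s).

Definition Ppoly (m : nat) (s : C) : C :=
  (\big[Cmult/RtoC 1]_(0 <= j < m) (s + natC j)) / natC m`!.

Definition moebius (n : nat) : C :=
  if (0 < n)%N && all (fun p => ~~ (p ^ 2 %| n)%N) (primes n)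
  then (- RtoC 1) ^ size (primes n) else RtoC 0.

Definition primitive_root (q : nat) (z : C) : Prop :=
  (0 < q)%N /\ z ^ q = RtoC 1 /\
  forall j : nat, (0 < j < q)%N -> z ^ j <> RtoC 1.

(* Main.v *)
Require Import Defs.
From Stdlib Require Import Reals Lra.
From mathcomp Require Import all_boot.
From Coquelicot Require Import Coquelicot.

(** Both sides are the sum of [z ^ N / N ^ s] over the positive integers [N]
coprime to [k].

On the left, [Li (z ^ d) s / d ^ s] is that sum restricted to the multiples of
[d] ([is_Cseries_multiples]), and the Moebius weights cancel every [N] sharing
a divisor with [k], since the Moebius function sums to zero over the divisors
of [gcd N k] unless that gcd is 1 ([sum_moebius_common_divisors]).

On the right, the integers are grouped around the multiples of [k]: every [N]
coprime to [k] is either some [h <= k / 2] or of the form [n k + h] or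
[n k - h] with [1 <= n] and [h <= k / 2] ([symmetric_blocks]); when [k] is even,
the midpoint of two consecutive multiples of [k] is itself a multiple of
[k / 2], which exceeds 1 since [2 < k], and so it is not coprime to [k]. As [k] is 1 modulo
the order of [z], [z ^ (n k + h) = z ^ n * z ^ h] and likewise for [n k - h].
With [e = h] or [e = - h], the binomial series in [e / (n k)], of modulus at
most 1/2, reads
  [(n k + e) ^ (- s) = sum_m P_m(s) (- e) ^ m / (n k) ^ (s + m)],
and summing it over [n] before [m] produces [Li z (s + m) / k ^ (s + m)]
([shifted_Li_expansion]).

The two analytic inputs are the binomial series for a complex exponent
([binomial_series]), proved through the differential equation
[(1 - x) f' = s f], and an exchange of summations ([Cseries_exchange]) for
double series dominated by a product [A n * B m], which suffices here because
[(n k) ^ (- s - m) e ^ m] is at most [n ^ (- Re s) / 2 ^ m] in modulus and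
the [P_m(s) / 2 ^ m] are absolutely summable ([ex_series_Ppoly]). *)

Local Open Scope C_scope.

(* The key [R] is otherwise taken by ring expressions. *)
Delimit Scope R_scope with R.

Local Notation is_Cseries := (@is_series C_AbsRing C_NormedModule).
Local Notation ex_Cseries := (@ex_series C_AbsRing C_NormedModule).

(** * Series of complex numbers *)

Lemma Csum_nE (a : nat -> C) n :
  sum_n a n = \big[Cplus/RtoC 0]_(0 <= i < n.+1) a i.
Proof.
elim: n => [|n IHn]; first by rewrite sum_O big_nat1.
by rewrite sum_Sn IHn [RHS]big_nat_recr.
Qed.

Lemma big_Cmult_distrr (I : Type) (r : seq I) (P : pred I) (F : I -> C) (c : C) :
  c * \big[Cplus/RtoC 0]_(i <- r | P i) F i =
  \big[Cplus/RtoC 0]_(i <- r | P i) (c * F i).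
Proof.
apply: (big_morph (Cmult c)) => [x y|]; [exact: Cmult_plus_distr_l|exact: Cmult_0_r].
Qed.

Lemma is_Cseries_scal (c : C) (a : nat -> C) (l : C) :
  is_Cseries a l -> is_Cseries (fun n => c * a n) (c * l).
Proof. exact: (@is_series_scal C_AbsRing C_NormedModule c). Qed.

Lemma is_Cseries_ext (a b : nat -> C) (l : C) :
  (forall n, a n = b n) -> is_Cseries a l -> is_Cseries b l.
Proof. exact: is_series_ext. Qed.

Lemma is_Cseries_inj (a : nat -> C) (l l' : C) :
  is_Cseries a l -> is_Cseries a l' -> l = l'.
Proof. by move=> /is_series_CSeries <- /is_series_CSeries. Qed.

Lemma is_Cseries_zero : is_Cseries (fun=> RtoC 0) (RtoC 0).
Proof.
apply: (filterlim_ext (fun=> RtoC 0)); last exact: filterlim_const.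
by move=> n; rewrite Csum_nE big1.
Qed.

Lemma is_Cseries_bigsum (I : Type) (r : seq I) (P : pred I)
    (a : I -> nat -> C) (l : I -> C) :
  (forall i, P i -> is_Cseries (a i) (l i)) ->
  is_Cseries (fun n => \big[Cplus/RtoC 0]_(i <- r | P i) a i n)
             (\big[Cplus/RtoC 0]_(i <- r | P i) l i).
Proof.
move=> al; elim: r => [|i r IHr].
  by rewrite big_nil; apply: is_Cseries_ext is_Cseries_zero => n; rewrite big_nil.
rewrite big_cons; case Pi: (P i); last first.
  by apply: is_Cseries_ext IHr => n; rewrite big_cons Pi.
apply: (is_Cseries_ext (fun n => a i n + \big[Cplus/RtoC 0]_(j <- r | P j) a j n)).
  by move=> n; rewrite big_cons Pi.
exact: (@is_series_plus C_AbsRing C_NormedModule) (al i Pi) IHr.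
Qed.

(** Grouping consecutive terms of [a] into single terms of [b], after dropping
a first group of sum [c], picks out a subsequence of the partial sums of [a]. *)
Lemma is_Cseries_regroup (a b : nat -> C) (l c : C) (phi : nat -> nat) :
  is_Cseries a l -> (forall n, (n <= phi n)%N) ->
  (forall n, c + \big[Cplus/RtoC 0]_(0 <= i < n.+1) b i =
             \big[Cplus/RtoC 0]_(0 <= i < (phi n).+1) a i) ->
  is_Cseries b (l - c).
Proof.
move=> al lephi ab.
apply: (filterlim_ext (fun n => sum_n a (phi n) - c)).
  by move=> n; rewrite !Csum_nE -ab; ring.
have phi_oo : filterlim phi eventually eventually.
  move=> P [N PN]; exists N => n /leP Nn; apply: PN.
  exact/leP/(leq_trans Nn).
have suba : filterlim (fun n => sum_n a (phi n)) eventually (locally (l : C_NormedModule)).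
  exact: filterlim_comp phi_oo al.
exact: (filterlim_comp_2 _ _ _ suba (filterlim_const (- c))
  (@filterlim_plus C_AbsRing C_NormedModule l (- c))).
Qed.

Lemma is_Cseries_norm_le (a : nat -> C) (b : nat -> R) (la : C) (lb : R) :
  (forall n, Rle (Cmod (a n)) (b n)) -> is_Cseries a la -> is_series b lb ->
  Rle (Cmod la) lb.
Proof.
move=> ab al bl.
have alim : is_lim_seq (fun n => Cmod (sum_n a n)) (Cmod la).
  apply: (filterlim_comp _ _ _ (sum_n a) Cmod _ _ _ al).
  exact: (@filterlim_norm C_AbsRing C_NormedModule).
have blim : is_lim_seq (sum_n b) lb by exact: bl.
apply: (is_lim_seq_le _ _ (Cmod la) lb _ alim blim) => n.
apply: (Rle_trans _ _ _ (@norm_sum_n_m C_AbsRing C_NormedModule a 0 n)).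
by apply: sum_n_m_le => m; apply: ab.
Qed.

Lemma ex_Cseries_le (a : nat -> C) (b : nat -> R) :
  (forall n, Rle (Cmod (a n)) (b n)) -> ex_series b -> ex_Cseries a.
Proof. exact: (@ex_series_le C_AbsRing C_CompleteNormedModule). Qed.

Lemma is_series_tail {K : AbsRing} {V : NormedModule K} (a : nat -> V) (l : V) M :
  is_series a l -> is_series (fun n => a (M.+1 + n)%coq_nat) (minus l (sum_n a M)).
Proof.
move=> al; apply: is_series_incr_n; first exact/ltP.
by rewrite /minus -plus_assoc plus_opp_l plus_zero_r.
Qed.

(** Cutting every row at [M] changes the row sum by at most [A n] times the tail
of [B] after [M], so the first [M] columns miss the total of the rows by at
most [Series A] times that tail, which tends to 0. *)
Lemma Cseries_exchange (a : nat -> nat -> C) (A B : nat -> R) (row col : nat -> C) :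
  (forall n m, Rle (Cmod (a n m)) (A n * B m)) ->
  ex_series A -> ex_series B ->
  (forall n, is_Cseries (a n) (row n)) ->
  (forall m, is_Cseries (fun n => a n m) (col m)) ->
  exists l, is_Cseries row l /\ is_Cseries col l.
Proof.
move=> aAB [sA Al] [sB Bl] arow acol.
have exrow : ex_Cseries row.
  have dom : ex_series (fun n => A n * sB)%R by apply: ex_series_scal_r; exists sA.
  apply: ex_Cseries_le dom.
  move=> n; apply: (is_Cseries_norm_le _ _ _ _ (aAB n) (arow n)).
  exact: (is_series_scal (A n)).
case: exrow => l rowl; exists l; split=> //.
pose t M := (sB - sum_n B M)%R.
have tlim : is_lim_seq (fun M => sA * t M)%R 0.
  have -> : 0%R = (sA * (sB - sB))%R by ring.
  apply: is_lim_seq_mult'; first exact: is_lim_seq_const.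
  apply: is_lim_seq_minus'; [exact: is_lim_seq_const|exact: Bl].
have bound M : Rle (Cmod (sum_n col M - l)) (sA * t M).
  rewrite -Cmod_opp.
  have -> : - (sum_n col M - l) = l - sum_n col M by ring.
  apply: (is_Cseries_norm_le (fun n => row n - sum_n (a n) M) (fun n => A n * t M)%R).
  - move=> n; apply: (is_Cseries_norm_le _ _ _ _ _ (is_series_tail _ _ M (arow n))).
      by move=> m; apply: aAB.
    exact: (is_series_scal (A n) _ _ (is_series_tail _ _ M Bl)).
  - apply: (@is_series_minus C_AbsRing C_NormedModule) rowl _.
    rewrite Csum_nE.
    apply: (is_Cseries_ext (fun n => \big[Cplus/RtoC 0]_(0 <= i < M.+1) a n i)).
      by move=> n; rewrite -Csum_nE.
    exact: is_Cseries_bigsum.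
  - exact: is_series_scal_r.
apply/(@filterlim_locally_ball_norm C_AbsRing _ C_NormedModule) => eps.
have [N PN] := proj1 (filterlim_locally _ _) tlim eps.
exists N => M /PN; rewrite /ball /= /AbsRing_ball /= /minus /plus /opp /abs /= => tM.
apply: (Rle_lt_trans _ _ _ (bound M)).
apply: Rle_lt_trans tM.
rewrite Ropp_0 Rplus_0_r; exact: Rle_abs.
Qed.

(** * Complex powers of positive reals *)

Lemma Cexp_add (x y : C) : Cexp (x + y) = Cexp x * Cexp y.
Proof.
rewrite /Cexp /= exp_plus cos_plus sin_plus.
by apply: injective_projections; rewrite /Re /Im /=; ring.
Qed.

Lemma Cmod_Cexp (x : C) : Cmod (Cexp x) = exp (Re x).
Proof.
rewrite /Cexp Cmod_mult Cmod_R Rabs_pos_eq; last exact/Rlt_le/exp_pos.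
rewrite /Cmod /=.
have -> : (cos (Im x) * (cos (Im x) * 1) + sin (Im x) * (sin (Im x) * 1) = 1)%R.
  by have := sin2_cos2 (Im x); rewrite /Rsqr; lra.
by rewrite sqrt_1 Rmult_1_r.
Qed.

Lemma Cexp_neq0 (x : C) : Cexp x <> 0.
Proof.
move=> x0; have := Cmod_Cexp x; rewrite x0 Cmod_0.
by have := exp_pos (Re x); lra.
Qed.

(** Extends [cpowN] to real bases: [cpowN n s] is [cpowR (INR n) s] by
conversion. The binomial series needs bases such as [1 - x]. *)
Definition cpowR (x : R) (s : C) : C := Cexp (s * RtoC (ln x)).

Lemma cpowR_neq0 x s : cpowR x s <> 0.
Proof. exact: Cexp_neq0. Qed.

Lemma cpowR_add x s t : cpowR x (s + t) = cpowR x s * cpowR x t.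
Proof. by rewrite /cpowR Cmult_plus_distr_r Cexp_add. Qed.

Lemma cpowR_zero x : cpowR x (RtoC 0) = 1.
Proof.
rewrite /cpowR Cmult_0_l /Cexp /= exp_0 cos_0 sin_0.
by apply: injective_projections => /=; ring.
Qed.

Lemma cpowR_opp x s : cpowR x (- s) = / cpowR x s.
Proof.
have /= nz := cpowR_neq0 x s.
have E : cpowR x s * cpowR x (- s) = 1.
  by rewrite -cpowR_add -(cpowR_zero x); congr cpowR; ring.
have -> : cpowR x (- s) = / cpowR x s * (cpowR x s * cpowR x (- s)) by field.
by rewrite E Cmult_1_r.
Qed.

Lemma cpowR_mul (x y : R) s : (0 < x)%R -> (0 < y)%R ->
  cpowR (x * y)%R s = cpowR x s * cpowR y s.
Proof.
by move=> x0 y0; rewrite /cpowR ln_mult // RtoC_plus Cmult_plus_distr_l Cexp_add.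
Qed.

Lemma cpowR_nat (x : R) m : (0 < x)%R -> cpowR x (natC m) = RtoC x ^ m.
Proof.
move=> x0; elim: m => [|m IHm]; first by rewrite cpowR_zero.
have -> : natC m.+1 = natC m + 1 by rewrite /natC S_INR RtoC_plus.
rewrite cpowR_add IHm Cpow_S Cmult_comm; congr (_ * _).
rewrite /cpowR Cmult_1_l /Cexp /= exp_ln // cos_0 sin_0.
by apply: injective_projections => /=; ring.
Qed.

Lemma Cmod_cpowR (x : R) (s : C) : Cmod (cpowR x s) = Rpower x (Re s).
Proof. by rewrite Cmod_Cexp /Rpower /Re /=; congr exp; ring. Qed.

(** With [a = sigma - 1], the terms are dominated by the telescoping differences
of [n ^ (- a) / a]: apply [1 + t <= exp t] to
[n ^ (- a) = (n + 1) ^ (- a) * exp (a (ln (n + 1) - ln n))], and bound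
[ln (n + 1) - ln n] below by [/ (n + 1)] in the same way. *)
Lemma ex_series_Riemann (sigma : R) : (1 < sigma)%R ->
  ex_series (fun n => Rpower (INR n.+1) (- sigma)).
Proof.
move=> s1; pose a := (sigma - 1)%R; have a0 : (0 < a)%R by rewrite /a; lra.
pose u n := Rpower (INR n.+1) (- a).
have upos n : (0 < u n)%R by exact: exp_pos.
have step n : (Rpower (INR n.+2) (- sigma) <= (u n - u n.+1) / a)%R.
  have n1 : (0 < INR n.+1)%R by apply: lt_0_INR; apply/ltP.
  have n2 : (0 < INR n.+2)%R by apply: lt_0_INR; apply/ltP.
  have -> : Rpower (INR n.+2) (- sigma) = (u n.+1 / INR n.+2)%R.
    rewrite /u; have -> : (- sigma = - a + - 1)%R by rewrite /a; ring.
    by rewrite Rpower_plus (Rpower_Ropp _ 1) Rpower_1.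
  have un : u n = (u n.+1 * exp (a * (ln (INR n.+2) - ln (INR n.+1))))%R.
    by rewrite /u /Rpower -exp_plus; congr exp; ring.
  have lnle : (/ INR n.+2 <= ln (INR n.+2) - ln (INR n.+1))%R.
    have := exp_ineq1_le (ln (INR n.+1) - ln (INR n.+2)).
    rewrite /Rminus exp_plus exp_Ropp !exp_ln //.
    have -> : (INR n.+1 * / INR n.+2 = 1 - / INR n.+2)%R.
      by rewrite (S_INR n.+1) in n2 *; field; lra.
    by lra.
  have := exp_ineq1_le (a * (ln (INR n.+2) - ln (INR n.+1))).
  have := upos n.+1.
  rewrite un; move: (u n.+1) (exp _) lnle => U E lnle U0 hE.
  apply: (Rmult_le_reg_r a) => //.
  have -> : ((U * E - U) / a * a = U * (E - 1))%R by field; lra.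
  have -> : (U / INR n.+2 * a = U * (a * / INR n.+2))%R by rewrite /Rdiv; ring.
  apply: Rmult_le_compat_l; first lra.
  have := Rmult_le_compat_l a _ _ (Rlt_le _ _ a0) lnle; lra.
apply/ex_series_incr_1.
apply: (@ex_series_le _ R_CompleteNormedModule _ (fun n => (u n - u n.+1) / a)%R).
  move=> n; rewrite /norm /= /abs /= Rabs_pos_eq; [exact: step|exact/Rlt_le/exp_pos].
apply: ex_series_scal_r.
have partial n : sum_n (fun n => u n - u n.+1)%R n = (u 0%N - u n.+1)%R.
  by elim: n => [|n IHn]; rewrite ?sum_O // sum_Sn IHn /plus /=; ring.
have [l lim] : exists l, is_lim_seq (fun n => u n.+1) (Finite l).
  have dec n : (u n.+2 <= u n.+1)%R.
    have := step n.+1; have := exp_pos (- sigma * ln (INR n.+3)) => p1 p2.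
    have p : (0 <= (u n.+1 - u n.+2) / a)%R by rewrite /Rpower in p2; lra.
    have := Rmult_le_compat_r a _ _ (Rlt_le _ _ a0) p.
    have -> : ((u n.+1 - u n.+2) / a * a = u n.+1 - u n.+2)%R by field; lra.
    by lra.
  exact: (ex_finite_lim_seq_decr _ 0%R dec (fun n => Rlt_le _ _ (upos n.+1))).
have lim0 : is_lim_seq (fun n => u 0%N - u n.+1)%R (u 0%N - l)%R.
  apply: is_lim_seq_minus' lim; exact: is_lim_seq_const.
exists (u 0%N - l)%R.
by apply: filterlim_ext lim0 => n; rewrite partial.
Qed.

(** * The binomial series *)

Lemma Ppoly_zero s : Ppoly 0 s = 1.
Proof. by rewrite /Ppoly big_geq // /natC /=; field. Qed.

Lemma natC_neq0 n : (0 < n)%N -> natC n <> 0.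
Proof.
move=> n0 /RtoC_inj; apply: not_0_INR => E.
by rewrite E in n0.
Qed.

Lemma natC_mul m n : natC (m * n)%N = natC m * natC n.
Proof. by rewrite /natC mult_INR RtoC_mult. Qed.

Lemma Ppoly_succ m s :
  natC m.+1 * Ppoly m.+1 s = (s + natC m) * Ppoly m s.
Proof.
rewrite /Ppoly big_nat_recr //= factS natC_mul.
have m1 := @natC_neq0 m.+1 isT.
have mf := natC_neq0 _ (fact_gt0 m).
by field.
Qed.

(** [rho (rho + 1) ... (rho + m - 1) / m!]: a positive real majorant for
[Ppoly m s], to which the ratio test applies; [Ppoly m s] itself may vanish. *)
Fixpoint rising (rho : R) (m : nat) : R :=
  if m is m'.+1 then (rising rho m' * ((rho + INR m') / INR m'.+1))%R else 1%R.

Lemma rising_succ rho m :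
  rising rho m.+1 = (rising rho m * ((rho + INR m) / INR m.+1))%R.
Proof. by []. Qed.

Lemma INR_S_gt0 n : (0 < INR n.+1)%R.
Proof. by apply: lt_0_INR; apply/ltP. Qed.

Lemma rising_gt0 rho m : (0 < rho)%R -> (0 < rising rho m)%R.
Proof.
move=> r0; elim: m => [|m IHm]; first by rewrite /=; lra.
have m1 := INR_S_gt0 m; have m0 := pos_INR m.
rewrite rising_succ; apply: Rmult_lt_0_compat => //.
by apply: Rdiv_lt_0_compat => //; lra.
Qed.

Lemma Cmod_Ppoly_le s m : (Cmod (Ppoly m s) <= rising (Cmod s + 1) m)%R.
Proof.
elim: m => [|m IHm]; first by rewrite Ppoly_zero Cmod_1 /=; lra.
have m1 := INR_S_gt0 m; have m0 := pos_INR m; have s0 := Cmod_ge_0 s.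
have -> : Ppoly m.+1 s = Ppoly m s * ((s + natC m) / natC m.+1).
  have n1 := @natC_neq0 m.+1 isT.
  have -> : Ppoly m.+1 s = natC m.+1 * Ppoly m.+1 s / natC m.+1 by field.
  by rewrite Ppoly_succ; field.
rewrite rising_succ Cmod_mult; apply: Rmult_le_compat => //; try exact: Cmod_ge_0.
rewrite Cmod_div; last exact: natC_neq0.
rewrite {2}/natC Cmod_R (Rabs_pos_eq (INR m.+1)); last lra.
apply: Rmult_le_compat_r; first exact/Rlt_le/Rinv_0_lt_compat.
apply: (Rle_trans _ _ _ (Cmod_triangle _ _)).
by rewrite /natC Cmod_R Rabs_pos_eq //; lra.
Qed.

Lemma ex_series_Ppoly s (r : R) : (0 < r < 1)%R ->
  ex_series (fun m => Cmod (Ppoly m s) * r ^ m)%R.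
Proof.
move=> [r0 r1]; pose rho := (Cmod s + 1)%R.
have s0 := Cmod_ge_0 s; have rho0 : (0 < rho)%R by rewrite /rho; lra.
have pos m : (0 < rising rho m * r ^ m)%R.
  by apply: Rmult_lt_0_compat; [exact: rising_gt0|exact: pow_lt].
apply: (@ex_series_le _ R_CompleteNormedModule _ (fun m => Rabs (rising rho m * r ^ m))).
  move=> m; rewrite /norm /= /abs /= !Rabs_pos_eq; first last.
  - by apply: Rmult_le_pos; [exact: Cmod_ge_0|exact/pow_le/Rlt_le].
  - exact/Rlt_le/pos.
  apply: Rmult_le_compat_r; first exact/pow_le/Rlt_le.
  exact: Cmod_Ppoly_le.
apply: (ex_series_DAlembert _ r) => // [m|]; first by have := pos m; lra.
apply: (is_lim_seq_ext (fun m => r + (rho - 1) * r * / INR m.+1)%R).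
  move=> m; have m1 := INR_S_gt0 m; have m0 := pos_INR m.
  rewrite Rabs_pos_eq; last exact/Rlt_le/Rdiv_lt_0_compat.
  have rm := pow_lt r m r0; have rim := rising_gt0 rho m rho0.
  rewrite rising_succ -[(r ^ m.+1)%R]/(r * r ^ m)%R.
  by rewrite S_INR in m1 *; field; lra.
have E : r = (r + (rho - 1) * r * 0)%R by ring.
rewrite [X in is_lim_seq _ (Finite X)]E.
apply: is_lim_seq_plus'; first exact: is_lim_seq_const.
apply: is_lim_seq_mult'; first exact: is_lim_seq_const.
apply: (proj1 (is_lim_seq_incr_1 (fun n => / INR n)%R 0%R)).
have oo : (p_infty : Rbar) <> Finite 0 by [].
exact: (is_lim_seq_inv _ _ is_lim_seq_INR oo).
Qed.

Lemma Re_mult_RtoC x (r : R) : Re (x * RtoC r) = (Re x * r)%R.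
Proof. by rewrite /Re /=; ring. Qed.

Lemma Im_mult_RtoC x (r : R) : Im (x * RtoC r) = (Im x * r)%R.
Proof. by rewrite /Im /=; ring. Qed.

Lemma Im_le_Cmod x : (Rabs (Im x) <= Cmod x)%R.
Proof. exact: Rle_trans (Rmax_r _ _) (Rmax_Cmod x). Qed.

(** Stated for any real functional [f] bounded by the modulus, because it serves
for both the real and the imaginary parts of the coefficients. *)
Lemma CV_radius_Ppoly (f : C -> R) s (x : R) :
  (forall y, Rabs (f y) <= Cmod y)%R ->
  (Rabs x < 1)%R -> Rbar_lt (Rabs x) (CV_radius (fun m => f (Ppoly m s))).
Proof.
move=> fle x1; pose r := ((Rabs x + 1) / 2)%R.
have x0 := Rabs_pos x.
have xr : (Rabs x < r)%R by rewrite /r; lra.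
have r01 : (0 < r < 1)%R by rewrite /r; lra.
apply: (Rbar_lt_le_trans _ (Finite r)); first exact: xr.
apply: (proj1 (Lub_Rbar_correct _)).
rewrite /CV_disk; apply: (@ex_series_le _ R_CompleteNormedModule _ _ _ (ex_series_Ppoly s r r01)).
move=> m; rewrite /norm /= /abs /= Rabs_Rabsolu Rabs_mult.
rewrite (Rabs_pos_eq (r ^ m)); last by apply: pow_le; lra.
by apply: Rmult_le_compat_r; [apply: pow_le; lra|exact: fle].
Qed.

Lemma constant_of_derive0 (f : R -> R) (x : R) : (Rabs x < 1)%R ->
  (forall y, (Rabs y < 1)%R -> is_derive f y 0%R) -> f x = f 0%R.
Proof.
move=> x1 df.
have inside y : (Rmin 0 x <= y <= Rmax 0 x)%R -> (Rabs y < 1)%R.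
  move=> [h1 h2]; move/Rabs_def2: x1 => [x1 x2].
  apply: Rabs_def1; first by apply: Rle_lt_trans h2 _; apply: Rmax_lub_lt; lra.
  by apply: Rlt_le_trans h1; apply: Rmin_glb_lt; lra.
have [] := MVT_gen f 0 x (fun=> 0%R).
- by move=> y hy; apply/df/inside; lra.
- move=> y hy; apply/continuity_pt_filterlim/ex_derive_continuous.
  by exists 0%R; apply/df/inside.
by move=> c [_]; lra.
Qed.

(** The real form of the equation [(1 - x) f' = s f] for [f = u + i v]. The
functions [g1] and [g2] are the real and imaginary parts of
[f x * (1 - x) ^ s], whose derivative vanishes. *)
Lemma binomial_ode (s : C) (u v du dv : R -> R) :
  (forall x, (Rabs x < 1)%R -> is_derive u x (du x)) ->
  (forall x, (Rabs x < 1)%R -> is_derive v x (dv x)) ->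
  (forall x, (Rabs x < 1)%R -> (1 - x) * du x = Re s * u x - Im s * v x)%R ->
  (forall x, (Rabs x < 1)%R -> (1 - x) * dv x = Re s * v x + Im s * u x)%R ->
  u 0%R = 1%R -> v 0%R = 0%R ->
  forall x, (Rabs x < 1)%R -> (u x, v x) = cpowR (1 - x) (- s).
Proof.
move=> uD vD odeu odev u0 v0 x x1.
set S := Re s in odeu odev; set T := Im s in odeu odev.
pose L y := ln (1 - y).
have dom y : (Rabs y < 1)%R -> (0 < 1 - y)%R.
  by move/Rabs_def2 => [? ?]; lra.
pose g1 y := (exp (S * L y) * (u y * cos (T * L y) - v y * sin (T * L y)))%R.
pose g2 y := (exp (S * L y) * (u y * sin (T * L y) + v y * cos (T * L y)))%R.
have g1D y : (Rabs y < 1)%R -> is_derive g1 y 0%R.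
  move=> y1; have y0 := dom y y1; have ud := uD y y1; have vd := vD y y1.
  rewrite /g1 /L; auto_derive.
    by do !split => //; [exists (du y)|exists (dv y)].
  rewrite -/(Rminus 1 y) (is_derive_unique _ _ _ ud) (is_derive_unique _ _ _ vd).
  have -> : du y = ((S * u y - T * v y) / (1 - y))%R by rewrite -odeu //; field; lra.
  have -> : dv y = ((S * v y + T * u y) / (1 - y))%R by rewrite -odev //; field; lra.
  by field; lra.
have g2D y : (Rabs y < 1)%R -> is_derive g2 y 0%R.
  move=> y1; have y0 := dom y y1; have ud := uD y y1; have vd := vD y y1.
  rewrite /g2 /L; auto_derive.
    by do !split => //; [exists (du y)|exists (dv y)].
  rewrite -/(Rminus 1 y) (is_derive_unique _ _ _ ud) (is_derive_unique _ _ _ vd).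
  have -> : du y = ((S * u y - T * v y) / (1 - y))%R by rewrite -odeu //; field; lra.
  have -> : dv y = ((S * v y + T * u y) / (1 - y))%R by rewrite -odev //; field; lra.
  by field; lra.
have L0 : L 0%R = 0%R by rewrite /L Rminus_0_r ln_1.
have G1 : g1 x = 1%R.
  rewrite (constant_of_derive0 g1 x x1 g1D) /g1 L0 u0 v0 !Rmult_0_r exp_0 cos_0 sin_0; ring.
have G2 : g2 x = 0%R.
  rewrite (constant_of_derive0 g2 x x1 g2D) /g2 L0 u0 v0 !Rmult_0_r exp_0 cos_0 sin_0; ring.
have prod1 : (u x, v x) * cpowR (1 - x) s = 1.
  rewrite /cpowR /Cexp Re_mult_RtoC Im_mult_RtoC -/S -/T -/(L x).
  apply: injective_projections => /=; [rewrite -[RHS]G1 /g1|rewrite -[RHS]G2 /g2]; ring.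
have nz := cpowR_neq0 (1 - x) s.
by rewrite cpowR_opp -[RHS]Cmult_1_l -prod1 -Cmult_assoc Cinv_r // Cmult_1_r.
Qed.

(** The recurrence [Ppoly_succ] for the coefficients, split into real and
imaginary parts, turned into a differential equation for the sums: the term
[INR m * a m] contributes [x] times the derivative. *)
Lemma PSeries_derive_rec (a b : nat -> R) (x : R) :
  Rbar_lt (Rabs x) (CV_radius a) -> Rbar_lt (Rabs x) (CV_radius b) ->
  forall S T : R,
  (forall m, INR m.+1 * a m.+1 = S * a m + T * b m + INR m * a m)%R ->
  ((1 - x) * PSeries (PS_derive a) x = S * PSeries a x + T * PSeries b x)%R.
Proof.
move=> ra rb S T rec.
have exa : ex_pseries a x by exact/CV_radius_inside.
have exb : ex_pseries b x by exact/CV_radius_inside.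
have exd : ex_pseries (PS_derive a) x.
  by apply/CV_radius_inside; rewrite CV_radius_derive.
suff : PSeries (PS_derive a) x = (S * PSeries a x + T * PSeries b x + x * PSeries (PS_derive a) x)%R by lra.
rewrite -PSeries_incr_1 -!PSeries_scal -!PSeries_plus.
- apply: PSeries_ext => m; rewrite /PS_plus /PS_scal /PS_derive /PS_incr_1 rec.
  rewrite /plus /scal /= /mult /=.
  case: m => [|m]; rewrite ?/zero //=; ring.
- by apply: ex_pseries_plus; apply: ex_pseries_scal => //; apply: Rmult_comm.
- exact: ex_pseries_incr_1.
- by apply: ex_pseries_scal => //; apply: Rmult_comm.
- by apply: ex_pseries_scal => //; apply: Rmult_comm.
Qed.

Lemma is_Cseries_pair (a : nat -> C) (u v : R) :
  is_series (fun n => Re (a n)) u -> is_series (fun n => Im (a n)) v ->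
  is_Cseries a (u, v).
Proof.
move=> au av.
have [re_sum im_sum] : (forall n, sum_n (fun n => Re (a n)) n = Re (sum_n a n)) /\
   (forall n, sum_n (fun n => Im (a n)) n = Im (sum_n a n)).
  by split; elim=> [|n IHn]; rewrite ?sum_O // !sum_Sn IHn.
apply/filterlim_locally => eps.
have h1 := proj1 (filterlim_locally (sum_n (fun n => Re (a n))) u) au eps.
have h2 := proj1 (filterlim_locally (sum_n (fun n => Im (a n))) v) av eps.
have [N1 {}h1] := h1; have [N2 {}h2] := h2.
exists (maxn N1 N2) => n /leP; rewrite geq_max => /andP [/leP /h1 hr /leP /h2 hi].
by split; [rewrite re_sum in hr|rewrite im_sum in hi].
Qed.

(** The sum of the series is the solution of [(1 - x) f' = s f], [f 0 = 1]. *)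
Lemma binomial_series (s : C) (x : R) : (Rabs x < 1)%R ->
  is_Cseries (fun m => Ppoly m s * RtoC x ^ m) (cpowR (1 - x) (- s)).
Proof.
move=> x1.
pose A m := Re (Ppoly m s); pose B m := Im (Ppoly m s).
have rA y : (Rabs y < 1)%R -> Rbar_lt (Rabs y) (CV_radius A).
  by apply: CV_radius_Ppoly; exact: re_le_Cmod.
have rB y : (Rabs y < 1)%R -> Rbar_lt (Rabs y) (CV_radius B).
  by apply: CV_radius_Ppoly; exact: Im_le_Cmod.
have recA m : (INR m.+1 * A m.+1 = Re s * A m + - Im s * B m + INR m * A m)%R.
  have := f_equal Re (Ppoly_succ m s); rewrite Cmult_comm /natC Re_mult_RtoC -/(A m.+1).
  by rewrite Rmult_comm => ->; rewrite /A /B /Re /Im /=; ring.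
have recB m : (INR m.+1 * B m.+1 = Re s * B m + Im s * A m + INR m * B m)%R.
  have := f_equal Im (Ppoly_succ m s); rewrite Cmult_comm /natC Im_mult_RtoC -/(B m.+1).
  by rewrite Rmult_comm => ->; rewrite /A /B /Re /Im /=; ring.
rewrite -(binomial_ode s (PSeries A) (PSeries B)
    (PSeries (PS_derive A)) (PSeries (PS_derive B))) //.
- apply: is_Cseries_pair.
    apply: (is_series_ext (fun m => A m * x ^ m)%R).
      by move=> m; rewrite -RtoC_pow Re_mult_RtoC.
    exact/is_pseries_R/PSeries_correct/CV_radius_inside/rA.
  apply: (is_series_ext (fun m => B m * x ^ m)%R).
    by move=> m; rewrite -RtoC_pow Im_mult_RtoC.
  exact/is_pseries_R/PSeries_correct/CV_radius_inside/rB.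
- by move=> y y1; apply/is_derive_PSeries/rA.
- by move=> y y1; apply/is_derive_PSeries/rB.
- by move=> y y1; rewrite (PSeries_derive_rec A B y (rA y y1) (rB y y1) _ _ recA); ring.
- by move=> y y1; rewrite (PSeries_derive_rec B A y (rB y y1) (rA y y1) _ _ recB); ring.
- by rewrite PSeries_0 /A Ppoly_zero.
- by rewrite PSeries_0 /B Ppoly_zero.
Qed.

Lemma binomial_series_shift (s : C) (N e : R) : (0 < N)%R -> (Rabs e < N)%R ->
  is_Cseries (fun m => Ppoly m s * RtoC (- e) ^ m / cpowR N (s + natC m))
             (/ cpowR (N + e) s).
Proof.
move=> N0 eN; pose x := (- e / N)%R.
have x1 : (Rabs x < 1)%R.
  rewrite /x Rabs_div; last lra.
  rewrite Rabs_Ropp (Rabs_pos_eq N); last lra.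
  by apply/Rlt_div_l => //; lra.
have pos : (0 < 1 - x)%R by move/Rabs_def2: x1 => [? ?]; lra.
have -> : (N + e = N * (1 - x))%R by rewrite /x; field; lra.
rewrite cpowR_mul //.
have nz1 := cpowR_neq0 N s; have nz2 := cpowR_neq0 (1 - x) s.
have nzN : RtoC N <> 0 by move=> /RtoC_inj; lra.
have -> : / (cpowR N s * cpowR (1 - x) s) = / cpowR N s * cpowR (1 - x) (- s).
  rewrite cpowR_opp; field; by [].
apply: is_Cseries_ext (is_Cseries_scal (/ cpowR N s) _ _ (binomial_series s x x1)) => m.
rewrite cpowR_add cpowR_nat // /x RtoC_div; last lra.
rewrite /Cdiv Cpow_mult_l Cpow_inv //.
have nzm := Cpow_nz _ m nzN.
by field.
Qed.

(** * Sums of the Moebius function over divisors *)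

(** Toggling a prime [p]: this is what makes the divisors of [n] prime to [p]
cancel against those divisible by [p] exactly once. *)
Lemma moebius_prime_mul p e : prime p -> (0 < e)%N ->
  moebius (p * e) = if (p %| e)%N then RtoC 0 else - moebius e.
Proof.
move=> pp e0; have p0 := prime_gt0 pp.
have pe0 : (0 < p * e)%N by rewrite muln_gt0 p0.
rewrite /moebius pe0 e0 /=; case: (boolP (p %| e)%N) => [/dvdnP [f def_e]|npe].
  rewrite -(negbK (all _ _)) -has_predC; suff -> : has (predC (fun r => ~~ (r ^ 2 %| p * e)%N)) (primes (p * e)) by [].
  apply/hasP; exists p; first by rewrite mem_primes pp pe0 dvdn_mulr.
  by rewrite /= negbK def_e mulnCA mulnn dvdn_mull.
have perm : perm_eq (primes (p * e)) (p :: primes e).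
  apply: uniq_perm; first exact: primes_uniq.
    by rewrite /= primes_uniq andbT mem_primes (negbTE npe) !andbF.
  by move=> r; rewrite inE primesM // primes_prime // inE.
rewrite (perm_all _ perm) (perm_size perm) /=.
have cop : coprime p e by rewrite prime_coprime // npe.
have -> : ~~ (p ^ 2 %| p * e)%N by rewrite -mulnn dvdn_pmul2l // npe.
have -> : all (fun r => ~~ (r ^ 2 %| p * e)%N) (primes e) = all (fun r => ~~ (r ^ 2 %| e)%N) (primes e).
  apply: eq_in_all => r; rewrite mem_primes => /and3P [pr _ re].
  rewrite Gauss_dvdr // coprimeXl // prime_coprime // dvdn_prime2 //.
  by apply: contraNN npe => /eqP <-.
by case: (all _ _) => /=; ring.
Qed.

(** For a prime [p] dividing [n], the divisors of [n] divisible by [p] are the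
[p * e] with [e] a divisor of [n / p]. Those with [p] dividing [e] contribute
0; the others contribute the opposite of [moebius e], and these [e] are
exactly the divisors of [n] not divisible by [p]. *)
Lemma sum_moebius_divisors n : (0 < n)%N ->
  \big[Cplus/RtoC 0]_(d <- divisors n) moebius d = if n == 1%N then RtoC 1 else RtoC 0.
Proof.
move=> n0; case: eqP => [->|/eqP n1].
  by rewrite big_seq1 /moebius /=.
have n2 : (1 < n)%N by rewrite ltn_neqAle eq_sym n1.
pose p := pdiv n; have pp : prime p := pdiv_prime n2.
have pn : (p %| n)%N := pdiv_dvd n.
have np0 : (0 < n %/ p)%N by rewrite divn_gt0 ?prime_gt0 // dvdn_leq.
rewrite (bigID (fun d => p %| d)%N) /=.
have -> : \big[Cplus/RtoC 0]_(d <- divisors n | (p %| d)%N) moebius d =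
          \big[Cplus/RtoC 0]_(e <- divisors (n %/ p)) moebius (p * e).
  rewrite -big_filter -(big_map (muln p) xpredT moebius); apply: perm_big; apply: uniq_perm.
  - exact/filter_uniq/divisors_uniq.
  - rewrite map_inj_uniq ?divisors_uniq // => x y /eqP.
    by rewrite eqn_pmul2l ?prime_gt0 // => /eqP.
  move=> d; rewrite mem_filter -dvdn_divisors //; apply/andP/mapP.
    move=> [/dvdnP [e ->] en]; exists e; last by rewrite mulnC.
    by rewrite -dvdn_divisors // dvdn_divRL.
  by move=> [e]; rewrite -dvdn_divisors // dvdn_divRL // => en ->; rewrite dvdn_mulr // mulnC.
have -> : \big[Cplus/RtoC 0]_(e <- divisors (n %/ p)) moebius (p * e) =
          \big[Cplus/RtoC 0]_(e <- divisors (n %/ p) | ~~ (p %| e)%N) (- moebius e).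
  rewrite [RHS]big_mkcond big_seq [RHS]big_seq; apply: eq_bigr => e.
  rewrite -dvdn_divisors // => en; rewrite moebius_prime_mul ?(dvdn_gt0 np0) //.
  by case: ifP => _ /=; rewrite ?if_neg.
have -> : \big[Cplus/RtoC 0]_(d <- divisors n | ~~ (p %| d)%N) moebius d =
          \big[Cplus/RtoC 0]_(e <- divisors (n %/ p) | ~~ (p %| e)%N) moebius e.
  rewrite -big_filter -[RHS]big_filter; apply: perm_big; apply: uniq_perm;
    try exact/filter_uniq/divisors_uniq.
  move=> d; rewrite !mem_filter -!dvdn_divisors //; apply: andb_id2l => npd.
  rewrite dvdn_divRL // mulnC Gauss_dvd; last by rewrite prime_coprime.
  by rewrite pn.
by rewrite -big_split /= big1 // => e _; ring.
Qed.

Lemma sum_moebius_common_divisors n k : (0 < k)%N ->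
  \big[Cplus/RtoC 0]_(d <- divisors k | (d %| n)%N) moebius d =
  if coprime n k then RtoC 1 else RtoC 0.
Proof.
move=> k0; have g0 : (0 < gcdn n k)%N by rewrite gcdn_gt0 k0 orbT.
rewrite /coprime -sum_moebius_divisors // -big_filter; apply: perm_big; apply: uniq_perm.
- exact/filter_uniq/divisors_uniq.
- exact: divisors_uniq.
by move=> d; rewrite mem_filter -!dvdn_divisors // dvdn_gcd.
Qed.

(** * Dirichlet series over multiples and over coprime integers *)

Lemma is_Cseries_Li (w t : C) : Cmod w = 1%R -> (1 < Re t)%R ->
  is_Cseries (fun n => w ^ n.+1 / cpowR (INR n.+1) t) (Li w t).
Proof.
move=> w1 t1.
have [l al] : ex_Cseries (fun n => w ^ n.+1 / cpowR (INR n.+1) t).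
  apply: (ex_Cseries_le _ _ _ (ex_series_Riemann _ t1)) => n.
  rewrite Cmod_div; last exact: cpowR_neq0.
  rewrite Cmod_pow w1 pow1 Cmod_cpowR Rpower_Ropp /Rdiv Rmult_1_l; exact: Rle_refl.
by rewrite /Li (is_series_CSeries al).
Qed.

Lemma sum_multiples (f : nat -> C) d M : (0 < d)%N ->
  \big[Cplus/RtoC 0]_(0 <= i < d * M) (if (d %| i.+1)%N then f i.+1 else RtoC 0) =
  \big[Cplus/RtoC 0]_(0 <= j < M) f (d * j.+1)%N.
Proof.
case: d => // d _; elim: M => [|M IHM]; first by rewrite muln0 !big_geq.
rewrite [RHS]big_nat_recr //= -IHM mulnS addnC.
rewrite (big_cat_nat (n := (d.+1 * M)%N)) ?leq_addr //=; congr (_ + _).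
rewrite addnS big_nat_recr ?leq_addr //= big_nat big1 ?Cplus_0_l.
  by rewrite -addnS -mulnSr dvdn_mulr.
move=> i /andP [i1 i2]; case: ifP => // /dvdnP [j ij].
have : (M * d.+1 < j * d.+1 < M.+1 * d.+1)%N.
  by rewrite -ij mulnC ltnS i1 mulSn addnC addnS !ltnS mulnC.
by rewrite !ltn_mul2r /= ltnS ltnNge; case: (j <= M)%N.
Qed.

(** Among [d] consecutive terms only one is nonzero, so regrouping them leaves
the series of the [z ^ (d j) / (d j) ^ s]; the sum is identified once the
convergence of the full series is known from its absolute convergence. *)
Lemma is_Cseries_multiples (z s : C) (d : nat) :
  Cmod z = 1%R -> (1 < Re s)%R -> (0 < d)%N ->
  is_Cseries
    (fun n => if (d %| n.+1)%N then z ^ n.+1 / cpowR (INR n.+1) s else RtoC 0)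
    (Li (z ^ d) s / cpowN d s).
Proof.
move=> z1 s1 d0; pose f n := z ^ n / cpowR (INR n) s.
have dR : (0 < INR d)%R by apply/lt_0_INR/ltP.
have nzd := cpowR_neq0 (INR d) s.
set a := (fun n => _).
have [l al] : ex_Cseries a.
  apply: (ex_Cseries_le _ _ _ (ex_series_Riemann _ s1)) => n.
  rewrite /a; case: ifP => _; last by rewrite Cmod_0; exact/Rlt_le/exp_pos.
  rewrite Cmod_div; last exact: cpowR_neq0.
  rewrite Cmod_pow z1 pow1 Cmod_cpowR Rpower_Ropp /Rdiv Rmult_1_l; exact: Rle_refl.
suff -> : Li (z ^ d) s / cpowN d s = l by [].
have bl : is_Cseries (fun j => f (d * j.+1)%N) (l - 0).
  apply: (is_Cseries_regroup a _ _ _ (fun M => (d * M.+1).-1) al) => M.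
    by rewrite -ltnS prednK ?muln_gt0 ?d0 // leq_pmull.
  by rewrite prednK ?muln_gt0 ?d0 // Cplus_0_l -sum_multiples.
have zd1 : Cmod (z ^ d) = 1%R by rewrite Cmod_pow z1 pow1.
have l0 : Cminus l 0 = l by ring.
rewrite {}l0 in bl; apply: is_Cseries_inj bl.
have -> : Li (z ^ d) s / cpowN d s = / cpowR (INR d) s * Li (z ^ d) s.
  by rewrite /cpowN -/(cpowR (INR d) s); field.
apply: is_Cseries_ext (is_Cseries_scal _ _ _ (is_Cseries_Li _ _ zd1 s1)) => j.
have nzj := cpowR_neq0 (INR j.+1) s.
rewrite /f mult_INR cpowR_mul //; last exact/lt_0_INR/ltP.
by rewrite Cpow_mult_r; field.
Qed.

(** The finite sum over [d] is taken inside the series, where the coefficient of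
[z ^ N / N ^ s] becomes a Moebius sum over the common divisors of [N] and
[k]. *)
Lemma is_Cseries_coprime (z s : C) (k : nat) :
  Cmod z = 1%R -> (1 < Re s)%R -> (0 < k)%N ->
  is_Cseries
    (fun n => if coprime n.+1 k then z ^ n.+1 / cpowR (INR n.+1) s else RtoC 0)
    (\big[Cplus/RtoC 0]_(d <- divisors k) (moebius d / cpowN d s * Li (z ^ d) s)).
Proof.
move=> z1 s1 k0.
have -> : \big[Cplus/RtoC 0]_(d <- divisors k) (moebius d / cpowN d s * Li (z ^ d) s) =
  \big[Cplus/RtoC 0]_(d <- divisors k | (0 < d)%N) (moebius d * (Li (z ^ d) s / cpowN d s)).
  rewrite big_seq [RHS]big_seq_cond; apply: eq_big => d.
    by case: (boolP (d \in _)) => //=; rewrite -dvdn_divisors // => /(dvdn_gt0 k0) ->.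
  by move=> _; rewrite /Cdiv; ring.
apply: (is_Cseries_ext (fun n => \big[Cplus/RtoC 0]_(d <- divisors k | (0 < d)%N)
   (moebius d * (if (d %| n.+1)%N then z ^ n.+1 / cpowR (INR n.+1) s else RtoC 0)))); last first.
  by apply: is_Cseries_bigsum => d d0; apply/is_Cseries_scal/is_Cseries_multiples.
move=> n; set x := _ / _.
transitivity (x * \big[Cplus/RtoC 0]_(d <- divisors k | (d %| n.+1)%N) moebius d).
  rewrite big_Cmult_distrr big_mkcond [RHS]big_mkcond; apply: eq_bigr => d _.
  case: (posnP d) => [->|d0] /=; first by rewrite ?dvd0n.
  by case: ifP => _; ring.
by rewrite sum_moebius_common_divisors //; case: ifP => _; ring.
Qed.

(** * Grouping around the multiples of k *)

Lemma big_nat_rev_below (c : nat -> C) X l : (l <= X)%N ->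
  \big[Cplus/RtoC 0]_(X - l <= N < X) c N =
  \big[Cplus/RtoC 0]_(1 <= h < l.+1) c (X - h)%N.
Proof.
elim: l => [|l IHl] lX; first by rewrite subn0 !big_geq.
rewrite big_nat_recr //= -IHl; last exact: ltnW.
have lt : (X - l.+1 < X)%N by rewrite ltn_subrL (leq_ltn_trans _ lX).
by rewrite big_ltn // subnSK // Cplus_comm.
Qed.

Lemma not_coprime_multiple d n k : (1 < d)%N -> (d %| n)%N -> (d %| k)%N ->
  ~~ coprime n k.
Proof.
move=> d1 dn dk; apply/negP => /eqP g.
have : (d %| 1)%N by rewrite -g dvdn_gcd dn.
by rewrite dvdn1 => /eqP d_1; rewrite d_1 in d1.
Qed.

(** The block of [n] consists of the integers at distance at most [k / 2] from
[n k]. For odd [k] the blocks partition the integers above [k / 2]. For even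
[k] the midpoint [n k - k / 2] lies in two blocks, which is harmless: [k / 2]
is greater than 1 and divides both this midpoint and [k], so [c] vanishes
there, as it does at the centres [n k]. *)
Lemma symmetric_blocks (c : nat -> C) (k M : nat) : (2 < k)%N ->
  (forall N, ~~ coprime N k -> c N = RtoC 0) ->
  \big[Cplus/RtoC 0]_(1 <= h < (k %/ 2).+1) c h +
  \big[Cplus/RtoC 0]_(0 <= n < M)
    \big[Cplus/RtoC 0]_(1 <= h < (k %/ 2).+1)
      (c (n.+1 * k + h)%N + c (n.+1 * k - h)%N) =
  \big[Cplus/RtoC 0]_(1 <= N < M * k + (k %/ 2).+1) c N.
Proof.
move=> k2 c0; set l := (k %/ 2)%N.
have lk : (l <= k)%N by exact: leq_div.
elim: M => [|M IHM]; first by rewrite [X in _ + X]big_geq // Cplus_0_r mul0n add0n.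
rewrite [X in _ + X]big_nat_recr //= Cplus_assoc {}IHM.
set X := (M.+1 * k)%N.
have kX : (k <= X)%N by rewrite /X leq_pmull.
have le1 : (M * k + l.+1 <= X)%N.
  rewrite /X mulSn addnC leq_add2r /l ltn_Pdiv //; exact: ltn_trans k2.
rewrite [RHS](big_cat_nat (n := (M * k + l.+1)%N)) /=; first last.
- by rewrite (leq_trans le1) // leq_addr.
- by rewrite addnS.
congr (_ + _); rewrite [RHS](big_cat_nat (n := X)) ?leq_addr //=.
rewrite big_split /= Cplus_comm; congr (_ + _); last first.
  rewrite [RHS]big_ltn; last by rewrite addnS ltnS leq_addr.
  rewrite [c X]c0 ?Cplus_0_l; last first.
    by apply: (not_coprime_multiple k) => //; [exact: ltn_trans k2|exact: dvdn_mull].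
  rewrite -(add1n X) big_addn addKn; apply: eq_bigr => h _.
  by rewrite addnC.
rewrite -big_nat_rev_below; last exact: leq_trans kX.
have kE : k = (odd k + l.*2)%N by rewrite /l divn2 odd_double_half.
have XE : X = (M * k + k)%N by rewrite /X mulSn addnC.
case: (boolP (odd k)) => k_odd; rewrite ?k_odd ?(negbTE k_odd) in kE.
  have -> : (M * k + l.+1 = X - l)%N; last by [].
  by rewrite XE {3}kE add1n -addnn -addSn addnA addnK.
rewrite add0n in kE.
have l1 : (1 < l)%N by rewrite -ltn_double -kE.
have XlE : (X - l = M * k + l)%N by rewrite XE {2}kE -addnn addnA addnK.
rewrite big_ltn; last by rewrite ltn_subrL (ltn_trans _ l1) // (leq_trans _ kX) // (ltn_trans _ k2).
rewrite c0 ?Cplus_0_l; first by rewrite XlE addnS.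
apply: (not_coprime_multiple l) => //; last by rewrite kE -addnn dvdn_add.
by rewrite XlE dvdn_addl // kE -addnn dvdn_mull // dvdn_add.
Qed.

Lemma coprime_multiple_sub n k h : (h <= n * k)%N ->
  coprime (n * k - h) k = coprime h k.
Proof.
move=> hnk; rewrite /coprime; congr (_ == _).
have dvd d : (d %| k)%N -> (d %| n * k - h)%N = (d %| h)%N.
  by move=> dk; rewrite dvdn_subr // dvdn_mull.
apply/eqP; rewrite eqn_dvd !dvdn_gcd !dvdn_gcdr !andbT.
by rewrite -dvd ?dvdn_gcdr // dvdn_gcdl dvd ?dvdn_gcdr // dvdn_gcdl.
Qed.

(** * Expansion of shifted polylogarithms *)

(** The core computation: [row n] is the binomial series in [e / (n k)], [col m]
is what its [m]-th terms add up to over [n]. The bound on [e] makes the ratio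
of the double series at most 1/2, uniformly in [n]. *)
Lemma shifted_Li_expansion (z s : C) (k : nat) (e : R) :
  Cmod z = 1%R -> (1 < Re s)%R -> (0 < k)%N -> (Rabs e <= INR k / 2)%R ->
  let row n := z ^ n.+1 / cpowR (INR (n.+1 * k) + e) s in
  let col m := Ppoly m s * Li z (s + natC m) / cpowN k (s + natC m)
               * RtoC (- e) ^ m in
  is_Cseries row (CSeries col) /\ is_Cseries col (CSeries col).
Proof.
move=> z1 s1 k0 ek row col.
suff [l [rl cl]] : exists l, is_Cseries row l /\ is_Cseries col l.
  by rewrite (is_series_CSeries cl).
have kR : (1 <= INR k)%R by rewrite -[1%R]/(INR 1); apply/le_INR/leP.
have sm m : (1 < Re (s + natC m))%R.
  by have := pos_INR m; rewrite /Re /natC /= -/(Re s); lra.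
pose N n := INR (n.+1 * k).
have NE n : N n = (INR n.+1 * INR k)%R by rewrite /N mult_INR.
have n1 n : (1 <= INR n.+1)%R by rewrite -[1%R]/(INR 1); apply/le_INR/leP.
have Nk n : (INR k <= N n)%R.
  by rewrite NE -[X in (X <= _)%R]Rmult_1_l; apply: Rmult_le_compat_r; lra || exact: n1.
have Nn n : (INR n.+1 <= N n)%R.
  rewrite NE -[X in (X <= _)%R]Rmult_1_r; apply: Rmult_le_compat_l => //.
  by have := n1 n; lra.
pose a n m := z ^ n.+1 * (Ppoly m s * RtoC (- e) ^ m / cpowR (N n) (s + natC m)).
apply: (Cseries_exchange a (fun n => Rpower (INR n.+1) (- Re s))
  (fun m => Cmod (Ppoly m s) * (/ 2) ^ m)%R).
- move=> n m; have N0 : (0 < N n)%R by have := Nk n; lra.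
  have nz1 := cpowR_neq0 (N n) s.
  have nzN : RtoC (N n) <> 0 by move=> /RtoC_inj; lra.
  have nz2 := Cpow_nz _ m nzN.
  rewrite /a cpowR_add cpowR_nat // Cmod_mult Cmod_pow z1 pow1 Rmult_1_l.
  rewrite Cmod_div; last exact: Cmult_neq_0.
  rewrite (Cmod_mult (Ppoly _ _)) (Cmod_mult (cpowR _ _)) !Cmod_pow Cmod_cpowR.
  rewrite !Cmod_R Rabs_Ropp (Rabs_pos_eq (N n)); last lra.
  have -> : (Cmod (Ppoly m s) * Rabs e ^ m / (Rpower (N n) (Re s) * N n ^ m) =
             Rpower (N n) (- Re s) * (Cmod (Ppoly m s) * (Rabs e / N n) ^ m))%R.
    rewrite Rpower_Ropp /Rdiv Rpow_mult_distr pow_inv.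
    have p1 : (0 < Rpower (N n) (Re s))%R by exact: exp_pos.
    have p2 := pow_lt (N n) m N0.
    by field; lra.
  have P0 := Cmod_ge_0 (Ppoly m s).
  have q0 : (0 <= Rabs e / N n)%R.
    by apply: Rdiv_le_0_compat => //; exact: Rabs_pos.
  apply: Rmult_le_compat.
  + exact/Rlt_le/exp_pos.
  + by apply: Rmult_le_pos => //; apply: pow_le.
  + rewrite !Rpower_Ropp; apply: Rinv_le_contravar; first exact: exp_pos.
    apply: Rle_Rpower_l; first lra.
    by have := n1 n; have := Nn n; lra.
  + apply: Rmult_le_compat_l => //; apply: pow_incr; split=> //.
    by apply/Rle_div_l => //; have := Nk n; lra.
- exact: ex_series_Riemann.
- by apply: ex_series_Ppoly; lra.
- move=> n; apply: (is_Cseries_scal (z ^ n.+1)); apply: binomial_series_shift.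
    by have := Nk n; lra.
  by have := Nk n; rewrite /N; lra.
- move=> m.
  have -> : col m = Ppoly m s * RtoC (- e) ^ m / cpowR (INR k) (s + natC m) * Li z (s + natC m).
    by rewrite /col /cpowN -/(cpowR (INR k) (s + natC m)); field; exact: cpowR_neq0.
  apply: is_Cseries_ext (is_Cseries_scal _ _ _ (is_Cseries_Li _ _ z1 (sm m))) => n.
  rewrite /a NE cpowR_mul; last lra; last by have := n1 n; lra.
  have := cpowR_neq0 (INR k) (s + natC m); have := cpowR_neq0 (INR n.+1) (s + natC m).
  by move=> ? ?; field.
Qed.

(** * The identity *)

Lemma root_of_unity_norm1 q z : primitive_root q z -> Cmod z = 1%R.
Proof.
move=> [q0 [zq _]]; have := Cmod_pow z q; rewrite zq Cmod_1 => /esym h.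
case: (pow_R1 _ _ h) => [|qE]; last by rewrite qE in q0.
by rewrite Rabs_pos_eq //; exact: Cmod_ge_0.
Qed.

Theorem theorem3 (s z : C) (q b k : nat)
  (hs : Rlt 1 (Re s))
  (hq : (1 <= q)%N) (hz : primitive_root q z)
  (hb : (0 < b)%N) (hk : (2 < k)%N) (hkbq : k = (b * q + 1)%N) :
  let term (m : nat) : C :=
    Ppoly m s * Li z (s + natC m) / cpowN k (s + natC m) *
    \big[Cplus/RtoC 0]_(1 <= h < (k %/ 2).+1 | coprime h k)
      ((z ^ h * (- RtoC 1) ^ m + / z ^ h) * natC h ^ m) in
  @ex_series C_AbsRing C_NormedModule term /\
  \big[Cplus/RtoC 0]_(d <- divisors k)
     (moebius d / cpowN d s * Li (z ^ d) s) =
  \big[Cplus/RtoC 0]_(1 <= h < (k %/ 2).+1 | coprime h k)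
     (z ^ h * cpowN h (- s))
  + CSeries term.
Proof.
move=> term.
have z1 := root_of_unity_norm1 _ _ hz.
have k0 : (0 < k)%N by exact: ltn_trans hk.
have z0 : z <> 0 by move=> z0; move: z1; rewrite z0 Cmod_0; lra.
have zk : z ^ k = z.
  have [_ [zq _]] := hz.
  by rewrite hkbq Cpow_add_r mulnC Cpow_mult_r zq Cpow_1_l Cpow_1_r Cmult_1_l.
have zmk n : z ^ (n * k)%N = z ^ n by rewrite mulnC Cpow_mult_r zk.
set l := (k %/ 2)%N in term *.
have lk2 : (l * 2 <= k)%N by exact: leq_trunc_div.
pose c N := if coprime N k then z ^ N / cpowR (INR N) s else RtoC 0.
have c0 N : ~~ coprime N k -> c N = RtoC 0 by rewrite /c => /negbTE ->.
set T := \big[_/_]_(d <- divisors k) _.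
have cT : is_Cseries (fun n => c n.+1) T := is_Cseries_coprime z s k z1 hs k0.
pose H := \big[Cplus/RtoC 0]_(1 <= h < l.+1) c h.
pose blk n := \big[Cplus/RtoC 0]_(1 <= h < l.+1)
      (c (n.+1 * k + h)%N + c (n.+1 * k - h)%N).
have blkT : is_Cseries blk (T - H).
  apply: (is_Cseries_regroup _ _ _ _ (fun n => (n.+1 * k + l).-1)%N cT) => n.
    rewrite -ltnS prednK; last by rewrite addn_gt0 muln_gt0 k0.
    by rewrite (leq_trans _ (leq_addr _ _)) // leq_pmulr.
  rewrite prednK; last by rewrite addn_gt0 muln_gt0 k0.
  rewrite /H /blk symmetric_blocks // big_add1 addnS //.
pose V e m := Ppoly m s * Li z (s + natC m) / cpowN k (s + natC m) * RtoC (- e) ^ m.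
pose U e n := z ^ n.+1 / cpowR (INR (n.+1 * k) + e) s.
have UV e : (Rabs e <= INR k / 2)%R ->
    is_Cseries (U e) (CSeries (V e)) /\ is_Cseries (V e) (CSeries (V e)).
  by move=> he; exact: shifted_Li_expansion.
have small h : (h < l.+1)%N -> (Rabs (INR h) <= INR k / 2)%R.
  move=> hl; rewrite Rabs_pos_eq; last exact: pos_INR.
  apply/Rle_div_r; first lra.
  rewrite -[2%R]/(INR 2) -mult_INR; apply/le_INR/leP.
  by apply: leq_trans lk2; rewrite leq_pmul2r.
pose P h := coprime h k && (0 < h < l.+1)%N.
(* Pairs the contributions of [n k + h] and [n k - h]; [both (U ^~ n) h] is a
   term of the block of [n], [both (V ^~ m) h] a term of [term m]. *)
pose both (f : R -> C) h := z ^ h * f (INR h) + / z ^ h * f (- INR h)%R.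
pose total := \big[Cplus/RtoC 0]_(1 <= h < l.+1 | P h) both (fun e => CSeries (V e)) h.
have inP (F : nat -> C) : \big[Cplus/RtoC 0]_(1 <= h < l.+1 | coprime h k) F h =
    \big[Cplus/RtoC 0]_(1 <= h < l.+1 | P h) F h.
  by rewrite big_nat_cond; apply: eq_bigl => h; rewrite /P andbC.
have bothP (f : nat -> R -> C) :
    (forall e, (Rabs e <= INR k / 2)%R -> is_Cseries (fun n => f n e) (CSeries (V e))) ->
    is_Cseries (fun n => \big[Cplus/RtoC 0]_(1 <= h < l.+1 | P h) both (f n) h) total.
  move=> fV; apply: is_Cseries_bigsum => h /andP [_ /andP [_ hl]].
  have hs1 := small h hl.
  apply: (@is_series_plus C_AbsRing C_NormedModule); apply: is_Cseries_scal; apply: fV => //.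
  by rewrite Rabs_Ropp.
have blk_total : is_Cseries blk total.
  apply: is_Cseries_ext (bothP (fun n e => U e n) _); last by move=> e /UV [].
  move=> n; rewrite -inP big_mkcond; apply: eq_big_nat => h /andP [h1 hl].
  have hX : (h <= n.+1 * k)%N.
    rewrite -ltnS; apply: leq_trans hl _; rewrite ltnS (leq_trans (leq_div k 2)) //.
    exact: leq_pmull.
  rewrite /c coprime_multiple_sub //.
  have -> : coprime (n.+1 * k + h) k = coprime h k.
    by rewrite coprime_sym /coprime gcdnMDl gcdnC.
  case: ifP => _; last by rewrite Cplus_0_l.
  have nz1 := Cpow_nz _ h z0.
  have zh : z ^ (n.+1 * k - h)%N = / z ^ h * z ^ n.+1.
    by rewrite -(zmk n.+1) -{2}(subnK hX) Cpow_add_r; field.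
  have Eplus : INR (n.+1 * k + h)%N = (INR (n.+1 * k) + INR h)%R by exact: plus_INR.
  have Eminus : INR (n.+1 * k - h)%N = (INR (n.+1 * k) + - INR h)%R.
    by apply: minus_INR; exact/leP.
  by rewrite /both /U Cpow_add_r zmk zh Eplus Eminus /Cdiv; ring.
have term_total : is_Cseries term total.
  apply: is_Cseries_ext (bothP (fun m e => V e m) _); last by move=> e /UV [].
  move=> m; rewrite -inP /term big_Cmult_distrr; apply: eq_bigr => h _.
  have nzk := cpowR_neq0 (INR k) (s + natC m).
  have nzh := Cpow_nz _ h z0.
  rewrite /both /V Ropp_involutive /cpowN -/(cpowR (INR k) (s + natC m)).
  have -> : RtoC (- INR h) = (- RtoC 1) * natC h by rewrite RtoC_opp /natC; ring.
  by rewrite Cpow_mult_l /natC; field.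
split; first by exists total.
rewrite (is_series_CSeries term_total) -(is_Cseries_inj _ _ _ blkT blk_total).
have -> : \big[Cplus/RtoC 0]_(1 <= h < l.+1 | coprime h k) (z ^ h * cpowN h (- s)) = H.
  rewrite big_mkcond; apply: eq_bigr => h _; rewrite /c; case: ifP => // _.
  by rewrite /cpowN -/(cpowR (INR h) (- s)) cpowR_opp.
by ring.
Qed.
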